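(* 1. There exists a topologically universal graph $(\mathbb{R},E)$ whose set of vertices is $\mathbb{R}$ and whose graph structure is shift-invariant. Likewise, there exists a topologically universal triangle-free graph (that is, a topologically $K_3$-free universal graph) $(\mathbb{R},E)$ whose set of vertices is $\mathbb{R}$ and whose graph structure is shift-invariant. 2. For every integer $s>3$ there exists a topologically $K_s$-free universal graph $(\mathbb{R},E)$ whose set of vertices is $\mathbb{R}$. For every integer $s>3$ there is no topologically $K_s$-free universal graph $(\mathbb{R},E)$ with set of vertices $\mathbb{R}$ whose graph structure is shift-invariant.
   Context: $\mathbb{R}$ carries its usual topology and additive group structure. A topological graph is a pair $(X,E)$ where $X$ is a Polish space and $E\subset X\times X$ is a closed symmetric subset with nonempty interior and empty intersection with the diagonal; $x,y\in X$ are joined by an edge iff $(x,y)\in E$. Put $E_x=\{y\in X:(x,y)\in E\}$ and $E'_x=X\setminus E_x$. The graph is pure if $E_x\neq E_y$ whenever $x\ne y$. A pure topological graph $(X,E)$ is topologically universal if for any two disjoint finite sets $\{x_1,\dots,x_n\},\{y_1,\dots,y_l\}\subset X$ the set $\bigcap_{i,j}(E_{x_i}\cap E'_{y_j})$ has nonempty interior. For an integer $s>2$, a topological graph $(X,E)$ is topologically $K_s$-free universal if (a) no $s$ distinct points of $X$ induce a complete graph $K_s$; and (b) for all positive integers $k,t$ and any two disjoint finite subsets $\{x_1,\dots,x_k\},\{y_1,\dots,y_t\}\subset X$ such that the graph induced on $\{x_1,\dots,x_k\}$ contains no complete subgraph $K_{s-1}$, the set $\bigcap_{i,j}(E_{x_i}\cap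 E'_{y_j})$ has nonempty interior in $X$. A graph structure $E\subset\mathbb{R}^2$ is shift-invariant if $E=\{(x,y):|x-y|\in Z\}$ for some $Z\subset(0,+\infty)$; equivalently, $(x,y)\in E\Leftrightarrow(x+h,y+h)\in E$ for all $h\in\mathbb{R}$. *)

(* Defs.v *)
From HB Require Import structures.
From mathcomp Require Import all_boot all_order all_algebra.
From mathcomp Require Import all_classical all_reals all_analysis.

Set Implicit Arguments.
Unset Strict Implicit.
Unset Printing Implicit Defensive.

Import Order.TTheory GRing.Theory Num.Theory.
Import numFieldNormedType.Exports.

Local Open Scope classical_set_scope.
Local Open Scope ring_scope.

Definition is_metric (R : realType) (X : Type) (d : X -> X -> R) : Prop :=
  [/\ forall x y, 0 <= d x y,
      forall x y, d x y = 0 <-> x = y,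
      forall x y, d x y = d y x
    & forall x y z, d x z <= d x y + d y z].

Definition metric_compatible (R : realType) (X : topologicalType)
    (d : X -> X -> R) : Prop :=
  forall (x : X) (U : set X),
    nbhs x U <-> exists2 e : R, 0 < e & [set y | d x y < e] `<=` U.

Definition metric_complete (R : realType) (X : topologicalType)
    (d : X -> X -> R) : Prop :=
  forall u : nat -> X,
    (forall e : R, 0 < e -> exists N : nat, forall m n : nat,
       (N <= m)%N -> (N <= n)%N -> d (u m) (u n) < e) ->
    exists x : X, u n @[n --> \oo] --> x.

(* [X] is a bare topological space: the complete metric is only required to
   exist and is not part of the structure.  The explicit [R] is the field in
   which metrics take their values. *)
Definition polish (R : realType) (X : topologicalType) : Prop :=
  (exists2 D : set X, countable D & dense D) /\
  (exists d : X -> X -> R,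
     [/\ is_metric d, metric_compatible d & metric_complete d]).

Definition topological_graph (R : realType) (X : topologicalType)
    (E : set (X * X)) : Prop :=
  [/\ polish R X,
      closed E,
      forall x y : X, E (x, y) -> E (y, x),
      interior E !=set0
    & forall x : X, ~ E (x, x)].

Definition nbr (X : Type) (E : set (X * X)) (x : X) : set X :=
  [set y | E (x, y)].

Definition pure_graph (X : Type) (E : set (X * X)) : Prop :=
  forall x y : X, x <> y -> nbr E x <> nbr E y.

(* The intersection of the sets E_a `\` E_b over all pairs (a, b), hence [setT]
   when [A] or [B] is empty. *)
Definition pattern (X : Type) (E : set (X * X)) (A B : set X) : set X :=
  \bigcap_(p in A `*` B) (nbr E p.1 `&` ~` nbr E p.2).

(* Allowing [A] or [B] to be empty costs nothing: the pattern is then [setT],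
   whose interior is nonempty because [E] is. *)
Definition topologically_universal (R : realType) (X : topologicalType)
    (E : set (X * X)) : Prop :=
  [/\ topological_graph R E,
      pure_graph E
    & forall A B : set X, finite_set A -> finite_set B -> A `&` B = set0 ->
        interior (pattern E A B) !=set0].

Definition has_clique (X : Type) (E : set (X * X)) (n : nat) (A : set X) :
    Prop :=
  exists f : 'I_n -> X,
    [/\ injective f,
        forall i, A (f i)
      & forall i j, i != j -> E (f i, f j)].

(* Meant for [2 < s].  Purity is not required here. *)
Definition topologically_Ks_free_universal (R : realType) (s : nat)
    (X : topologicalType) (E : set (X * X)) : Prop :=
  [/\ topological_graph R E,
      ~ has_clique E s [set: X]
    & forall A B : set X, finite_set A -> finite_set B ->
        A !=set0 -> B !=set0 -> A `&` B = set0 ->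
        ~ has_clique E s.-1 A ->
        interior (pattern E A B) !=set0].

Definition shift_invariant (R : realType) (E : set (R * R)) : Prop :=
  exists2 Z : set R, (forall z, Z z -> 0 < z) &
    E = [set p : R * R | Z `|p.1 - p.2|].

(* Main.v *)
Require Import Defs.
From mathcomp Require Import all_boot all_order all_algebra.
From mathcomp Require Import lra zify.
From mathcomp Require Import all_classical all_reals all_analysis.
Import Order.TTheory GRing.Theory Num.Theory.
Import numFieldNormedType.Exports.
Set Implicit Arguments.
Unset Strict Implicit.
Unset Printing Implicit Defensive.
Local Open Scope classical_set_scope.
Local Open Scope ring_scope.

(** Existence. Finite subsets of R are approximated by countably many finite
    unions of short closed intervals with rational centres; call the n-th one
    the target of stage n. Stage n adds edges that join every point near a far
    away centre to exactly the points of the target, up to a small error, and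
    it is skipped if the target already contains a forbidden clique. Since the
    edge set is closed, a finite set without a forbidden clique has a
    neighbourhood without one, so it is served by some stage that is not
    skipped. Letting stage n only prescribe lengths of edges yields a
    shift-invariant graph, which can be kept triangle-free; attaching only the
    points near the centre yields a K_s-free graph for every s > 2.

    Non-existence. Translating a clique W by a suitable vector c gives a set
    W - c which is nearly unrelated to W; a common neighbour b of both gives the
    clique formed by W, b and b + c, because (w, b + c) is a translate of
    (w - c, b). *)

(** * Finite sets and cliques *)

Lemma finite_near (I T : Type) (F : set_system I) (A : set T)
    (P : T -> I -> Prop) :
  Filter F -> finite_set A -> (forall x, A x -> \forall i \near F, P x i) ->
  \forall i \near F, forall x, A x -> P x i.
Proof.
move=> FF; elim/Pchoice: T => T in A P *.
move=> /finite_seqP[s ->]; elim: s => [|a s IHs] Ps.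
  by near=> i => x; rewrite /= in_nil.
have Ha : \forall i \near F, P a i by apply: Ps; rewrite /= mem_head.
have Hs : \forall i \near F, forall x, [set` s] x -> P x i.
  by apply: IHs => x /= xs; apply: Ps; rewrite /= inE xs orbT.
near=> i => x /=; rewrite inE => /orP[/eqP ->|xs].
- by near: i.
- by move: x xs; near: i.
Unshelve. all: by end_near. Qed.

Lemma finite_bounded (R : realType) (A : set R) :
  finite_set A -> \forall n \near \oo, forall x, A x -> `|x| <= n%:R.
Proof.
move=> finA; apply: finite_near => // x _.
exists (Num.Def.archi_bound `|x|) => // n /= xn.
by rewrite (le_trans (ltW (archi_boundP _))) ?ler_nat.
Qed.

Lemma edges_injective (X : Type) (E : set (X * X)) n (f : 'I_n -> X) :
  (forall x, ~ E (x, x)) -> (forall i j, i != j -> E (f i, f j)) ->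
  injective f.
Proof.
move=> irrE Ef i j fij; apply: contrapT => /eqP/Ef.
by rewrite fij => /irrE.
Qed.

(** The values of [g] are recorded so that a further vertex can be attached to the extended
    clique. *)
Lemma has_cliqueS (X : Type) (E : set (X * X)) n (f : 'I_n -> X) (z : X) :
  (forall x, ~ E (x, x)) -> (forall x y, E (x, y) -> E (y, x)) ->
  (forall i j, i != j -> E (f i, f j)) -> (forall i, E (f i, z)) ->
  exists g : 'I_n.+1 -> X,
    [/\ g ord_max = z, forall i, g (lift ord_max i) = f i
      & forall i j, i != j -> E (g i, g j)].
Proof.
move=> irrE symE Ef fz.
exists (fun i => oapp f z (unlift ord_max i)); split.
- by rewrite unlift_none.
- by move=> i; rewrite liftK.
move=> i j; case: unliftP => [i'|] ->; case: unliftP => [j'|] -> //=.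
- by rewrite (inj_eq lift_inj) => /Ef.
- by move=> _; exact: symE.
- by rewrite eqxx.
Qed.

Lemma has_clique_range (X : Type) (E : set (X * X)) m n (f : 'I_n -> X) :
  has_clique E m (range f) -> (m <= n)%N.
Proof.
move=> [g [ginj gf _]].
have [h hP] : {h : 'I_m -> 'I_n & forall i, f (h i) = g i}.
  apply: (@choice _ _ (fun i j => f j = g i)) => i.
  by have [j _ <-] := gf i; exists j.
rewrite -(card_ord m) -(card_ord n); apply: (@leq_card _ _ h) => i j hij.
by apply: ginj; rewrite -!hP hij.
Qed.

(** * Non-existence: shift-invariant graphs for [s > 3] *)

Section universal_extension.
Variables (R : realType) (s : nat) (E : set (R * R)).
Hypothesis univE : topologically_Ks_free_universal R s E.

Lemma universal_irreflexive x : ~ E (x, x).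
Proof. by case: univE => -[_ _ _ _ irrE] _ _; exact: irrE. Qed.

Lemma universal_symmetric x y : E (x, y) -> E (y, x).
Proof. by case: univE => -[_ _ symE _ _] _ _; exact: symE. Qed.

(** Universality speaks of nonempty [B] only. Adding to [B] a point outside [A], which exists
    because finite sets are bounded, covers empty [B] as well. *)
Lemma universal_witness (A B : set R) :
  finite_set A -> finite_set B -> A !=set0 -> A `&` B = set0 ->
  ~ has_clique E s.-1 A ->
  exists z, (forall a, A a -> E (a, z)) /\ (forall b, B b -> ~ E (b, z)).
Proof.
move=> finA finB [a Aa] AB0 noA.
have [_ _ univ] := univE.
have [y yA] : exists y, ~ A y.
  have [n _ /(_ n (leqnn n)) An] := finite_bounded finA.
  by exists n.+1%:R => /An; rewrite normr_nat ler_nat ltnn.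
have [||||||z /interior_subset zP] := univ A (y |` B) => //.
- by rewrite finite_setU; split.
- by exists a.
- by exists y; left.
- rewrite setIUr AB0 setU0; apply/seteqP; split => // x [Ax xy].
  by apply: yA; rewrite -xy.
exists z; split=> [b Ab|b Bb].
- by have /zP[] : (A `*` (y |` B)) (b, y) by split => //; left.
- by have /zP[] : (A `*` (y |` B)) (a, b) by split => //; right.
Qed.

(** Greedy construction: fewer than [s - 1] points contain no clique of size [s - 1], so a clique
    that small has a common neighbour. *)
Lemma universal_clique n : (n < s)%N ->
  exists f : 'I_n -> R, forall i j, i != j -> E (f i, f j).
Proof.
elim: n => [|n IHn] ns; first by exists (fun=> 0) => -[].
have [f Ef] := IHn (ltnW ns).
suff [z fz] : exists z, forall i, E (f i, z).
  have [g [_ _ Eg]] :=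
    has_cliqueS universal_irreflexive universal_symmetric Ef fz.
  by exists g.
case: n => [|n] in f Ef ns {IHn} *; first by exists 0 => -[].
have [|||||z [fz _]] := @universal_witness (range f) set0.
- by apply: finite_image; exact: finite_finset.
- exact: finite_set0.
- by exists (f ord0), ord0.
- by rewrite setI0.
- move=> /has_clique_range.
  by rewrite leqNgt -ltnS prednK ?ns// (leq_trans _ ns).
- by exists z => i; apply: fz; exists i.
Qed.

End universal_extension.

Lemma shift_invariantE (R : realType) (E : set (R * R)) x y x' y' :
  shift_invariant E -> E (x, y) -> x' - y' = x - y \/ x' - y' = y - x ->
  E (x', y').
Proof.
move=> [Z _ ->] /= Zxy [->//|->].
by rewrite distrC.
Qed.

(* Let [W] be a clique with [s - 2] vertices and [c] a neighbour of [0] not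
   adjacent to any difference of two vertices of [W]. Then between [W] and
   [W - c] only the pairs [w, w - c] are edges, so [W] and [W - c] together
   contain no clique of size [s - 1 > 2] and have a common neighbour [b]; but
   then [W] together with [b] and [b + c] is a clique of size [s]. *)
Lemma shift_invariant_not_universal (R : realType) (s : nat)
    (E : set (R * R)) :
  (3 < s)%N -> shift_invariant E -> ~ topologically_Ks_free_universal R s E.
Proof.
move=> s3 shiftE univE.
have irrE := universal_irreflexive univE.
have symE := universal_symmetric univE.
have shE x y x' y' := @shift_invariantE R E x y x' y' shiftE.
case: s => [|[|[|[|s]]]] // in s3 univE *.
have [W EW] : exists f : 'I_s.+2 -> R, forall i j, i != j -> E (f i, f j).
  by apply: (universal_clique univE); rewrite ltnS; apply: leqW.
pose D := [set W p.1 - W p.2 | p in [set p : 'I_s.+2 * 'I_s.+2 | p.1 != p.2]].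
have [|||||c [c0 cD]] := @universal_witness _ _ _ univE [set 0] D.
- exact: finite_set1.
- exact: finite_image.
- by exists 0.
- apply/seteqP; split => // x [-> [[i j] /= /EW Eij /eqP]].
  by rewrite subr_eq0 => /eqP Wij; move: Eij; rewrite Wij => /irrE.
- move=> [f [finj f0 _]]; have := finj ord0 ord_max.
  by rewrite (f0 ord0) (f0 ord_max) => /(_ erefl).
have {}c0 : E (0, c) by exact: c0.
have {}cD i j : i != j -> ~ E (W i, W j - c).
  move=> ij Eij; apply: (cD (W j - W i)).
    by exists (j, i) => //=; rewrite eq_sym.
  by apply: shE Eij _; right; lra.
pose V (p : bool * 'I_s.+2) := if p.1 then W p.2 - c else W p.2.
have [|||||b [Vb _]] := @universal_witness _ _ _ univE (range V) set0.
- by apply: finite_image; exact: finite_finset.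
- exact: finite_set0.
- by exists (W ord0), (false, ord0).
- by rewrite setI0.
- move=> [g [ginj gV Eg]].
  have [h hP] : {h : 'I_s.+3 -> bool * 'I_s.+2 & forall i, V (h i) = g i}.
    apply: (@choice _ _ (fun i p => V p = g i)) => i.
    by have [p _ <-] := gV i; exists p.
  have hinj i j : h i = h j -> i = j.
    by move=> hij; apply: ginj; rewrite -!hP hij.
  have crossh i j : (h i).1 != (h j).1 -> (h i).2 = (h j).2.
    move=> hij; apply: contrapT => /eqP ne2.
    have : E (g i, g j) by apply: Eg; apply: contraNneq hij => ->.
    move: hij ne2; rewrite -!hP /V.
    case: (h i) (h j) => -[] p [[] q] //= _ pq.
    + by move=> /symE; apply: cD; rewrite eq_sym.
    + exact: cD.
  (* Pigeonhole: the clique has one vertex more than [W], so it contains some [w] together with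
     [w - c]. *)
  have : ~~ injectiveb (fun i => (h i).2).
    apply/injectiveP => /leq_card; rewrite !card_ord.
    by rewrite ltnn.
  move=> /injectivePn[i [j ij hij2]].
  have hij1 : (h i).1 != (h j).1.
    apply: contra ij => /eqP hij1; apply/eqP/hinj.
    by rewrite [LHS]surjective_pairing hij1 hij2 -surjective_pairing.
  (* Here [s > 3] provides a third vertex. Its copy differs from that of [i] or of [j]; by [crossh]
     it then has their common index in [W] and coincides with the other of the two. *)
  have [k ki kj] : exists2 k : 'I_s.+3, k != i & k != j.
    have : (0 < #|~: [set i; j]%SET|)%N.
      by rewrite cardsCs finset.setCK card_ord cards2 ij.
    by move=> /card_gt0P[k]; rewrite !inE negb_or => /andP[]; exists k.
  have [hki|hki] := eqVneq (h k).1 (h i).1.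
  - have : (h k).1 != (h j).1 by rewrite hki.
    move/crossh => hkj; move: ki => /eqP; apply; apply: hinj.
    by rewrite [LHS]surjective_pairing hki hkj -hij2 -surjective_pairing.
  - have hkj : (h k).1 = (h j).1.
      by move: hij1 hki; case: (h i).1 (h j).1 (h k).1 => -[] [].
    move/crossh: hki => hki; move: kj => /eqP; apply; apply: hinj.
    by rewrite [LHS]surjective_pairing hkj hki hij2 -surjective_pairing.
have Wb i : E (W i, b) by apply: Vb; exists (false, i).
have Wcb i : E (W i, b + c).
  have : E (W i - c, b) by apply: Vb; exists (true, i).
  by move=> /shE; apply; left; lra.
have [f1 [f1max f1W Ef1]] := has_cliqueS irrE symE EW Wb.
have f1bc i : E (f1 i, b + c).
  case: (unliftP ord_max i) => [j|] ->; rewrite ?f1W ?f1max//.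
  by apply: shE c0 _; left; lra.
have [f2 [_ _ Ef2]] := has_cliqueS irrE symE Ef1 f1bc.
have [_ noK _] := univE; apply: noK.
by exists f2; split => //; exact: edges_injective Ef2.
Qed.

(** * Topology of the real line and closed edge sets *)

Lemma polish_real (R : realType) : polish R R.
Proof.
split.
  exists (range (@ratr R)); last exact: dense_rat.
  exact: card_le_trans (card_image_le _ _) (countableP _).
exists (fun x y => `|x - y|); split.
- split=> [x y|x y|x y|x y z]; [exact: normr_ge0| |exact: distrC|].
  + by split=> [/eqP|->]; rewrite ?subrr ?normr0// normr_eq0 subr_eq0 => /eqP.
  + exact: ler_distD.
- by move=> x U; exact: nbhs_ballP.
- move=> u cu; exists (lim (u @ \oo)); apply: R_complete; apply/cauchy_exP.
  by move=> e /cu[N uN]; exists (u N), N => // n /= Nn; exact: uN.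
Qed.

Lemma closed_norm_le (R : realType) (T : topologicalType) (f : T -> R) (r : R) :
  continuous f -> closed [set t | `|f t| <= r].
Proof.
move=> cf; apply: (@preimage_closed _ _ _ [set y | y <= r]).
  by apply: in1W => t; apply: cvg_norm; exact: cf.
exact: closed_le.
Qed.

Lemma closed_nonedge (R : realType) (E : set (R * R)) (p : R * R) :
  closed E -> ~ E p ->
  exists2 e : R, 0 < e &
    forall x y, `|x - p.1| < e -> `|y - p.2| < e -> ~ E (x, y).
Proof.
move=> clE nEp.
have /nbhs_ballP[e /= e0 pe] : nbhs p (~` E).
  by apply: open_nbhs_nbhs; split => //; exact: closed_openC.
exists e => // x y xe ye.
by apply: (pe (x, y)); split => /=; rewrite /ball /= distrC.
Qed.

Lemma has_clique2 (X : Type) (E : set (X * X)) (A : set X) x y :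
  (forall x, ~ E (x, x)) -> (forall x y, E (x, y) -> E (y, x)) ->
  A x -> A y -> E (x, y) -> has_clique E 2 A.
Proof.
move=> irrE symE Ax Ay Exy; exists (fun i : 'I_2 => if i == ord0 then x else y).
have Ef (i j : 'I_2) : i != j ->
    E (if i == ord0 then x else y, if j == ord0 then x else y).
  case: (unliftP ord0 i) => [i'|] ->; case: (unliftP ord0 j) => [j'|] -> //=.
  - by rewrite !ord1 eqxx.
  - by move=> _; exact: symE.
split => //; last by move=> i; case: ifP.
exact: edges_injective irrE Ef.
Qed.

(** * Enumeration of targets and separation of lengths *)

Section code.
Variable R : realType.

(* A code [(l, m, M)] stands for the points of [l] with precision [1 / (m + 1)],
   to be distinguished from the other points of [-M, M]. *)
Definition code n : seq rat * nat * nat := odflt ([::], 0%N, 0%N) (unpickle n).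

Definition points n : set R := [set ratr q | q in [set` (code n).1.1]].

Definition radius n : R := (code n).1.2.+1%:R^-1.

Definition reach n : nat := (code n).2.

Definition target n : set R :=
  [set x | `|x| <= (reach n)%:R] `&`
  \bigcup_(q in points n) [set x | `|x - q| <= radius n].

(* The recurrence makes every length in the window of stage [n] larger than
   twice the lengths in the earlier windows and than the diameter
   [2 * reach n] of the target. *)
Fixpoint upper n : nat :=
  if n is k.+1 then (2 * upper k + 4 * reach n + 3)%N else (4 * reach 0 + 3)%N.

Definition center n : R := (upper n)%:R - (reach n)%:R - 1.

(** These are the distances between points of [[-reach n, reach n]] and points within 1 of the
    centre; the largest is [upper n]. *)
Definition window n : set R :=
  [set d | center n - (reach n)%:R - 1 <= d <= center n + (reach n)%:R + 1].

Lemma reach_ge0 n : 0 <= (reach n)%:R :> R. Proof. exact: ler0n. Qed.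

Lemma radius_gt0 n : 0 < radius n.
Proof. by rewrite invr_gt0 ltr0n. Qed.

Lemma radius_le1 n : radius n <= 1.
Proof. by rewrite invf_le1 ?ltr0n// ler1n. Qed.

Lemma upper_reach n : (4 * reach n + n.+3 <= upper n)%N.
Proof. by elim: n => [|n IHn] /=; lia. Qed.

Lemma upper_lt k n : (k < n)%N ->
  (2 * upper k + 4 * reach n + 3 <= upper n)%N.
Proof.
elim: n => // n IHn; rewrite ltnS leq_eqVlt => /orP[/eqP -> //|/IHn] /=; lia.
Qed.

Lemma window_reach n d : window n d -> 2 * (reach n)%:R + n.+1%:R <= d.
Proof.
have := upper_reach n; rewrite -(ler_nat R) natrD (natrM _ 4).
rewrite -(@natr1 _ n.+2) -(@natr1 _ n.+1).
by rewrite /window /center /= => h /andP[+ _]; lra.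
Qed.

Lemma window_lt k n d d' : (k < n)%N -> window k d -> window n d' -> 2 * d < d'.
Proof.
move=> /upper_lt; rewrite -(ler_nat R) (natrD _ _ 3) natrD.
rewrite (natrM _ 2) (natrM _ 4) /window /center /=.
have := reach_ge0 n; have := reach_ge0 k; move=> ? ? ? /andP[? ?] /andP[? ?].
lra.
Qed.

Lemma window_reach_le k n d : (k <= n)%N -> window n d ->
  2 * (reach k)%:R < d.
Proof.
rewrite leq_eqVlt => /orP[/eqP ->|kn] wd.
  have := window_reach wd; have : 0 < n.+1%:R :> R by rewrite ltr0n.
  lra.
have [ck wck] : exists d', window k d'.
  by exists (center k); rewrite /window /=; have := reach_ge0 k; lra.
have := window_reach wck; have := window_lt kn wck wd.
have : 0 < k.+1%:R :> R by rewrite ltr0n.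
have := reach_ge0 k; lra.
Qed.

Lemma target_closed n : closed (target n).
Proof.
apply: closedI; first by apply: closed_norm_le => x; exact: cvg_id.
apply: closed_bigcup => [|q _]; first by apply: finite_image; exact: finite_seq.
by apply: closed_norm_le => x; apply: cvgB; [exact: cvg_id|exact: cvg_cst].
Qed.

(** Rational approximation, with every triple having a code. The error [e] is independent of the
    radius, so the centres can approximate [A] better than the precision of the target. *)
Lemma code_exists (A : set R) (m M : nat) (e : R) : finite_set A -> 0 < e ->
  exists n, [/\ radius n = m.+1%:R^-1, reach n = M,
    forall a, A a -> exists2 q, points n q & `|q - a| < e
  & forall q, points n q -> exists2 a, A a & `|q - a| < e].
Proof.
move=> finA e0.
have [f fP] : {f : R -> rat & forall a, `|ratr (f a) - a| < e}.
  apply: (@choice _ _ (fun a q => `|ratr q - a| < e)) => a.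
  have [q] := @rat_in_itvoo R (a - e) (a + e) ltac:(lra).
  by rewrite in_itv /= => qa; exists q; rewrite ltr_distl.
have [l lP] := (finite_seqP (f @` A)).1 (finite_image f finA).
have lE q : (q \in l : Prop) = (f @` A) q by rewrite lP.
exists (pickle (l, m, M)).
rewrite /radius /reach /points /code pickleK /=; split => //.
- move=> a Aa; exists (ratr (f a)) => //; exists (f a) => //=.
  by rewrite lE; exists a.
- by move=> _ [q /= + <-]; rewrite lE => -[a Aa <-]; exists a.
Qed.

End code.

(** * The staged construction for arbitrary pieces [D n] *)

Section staged_graph.
Variables (R : realType) (K : set nat) (D : nat -> set (R * R)).

(** [K] holds the clique sizes forbidden in targets: it is empty for the universal graph, where no
    stage is skipped, and [{s - 1}] for a [K_s]-free graph. *)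
Definition clique_free (S : set (R * R)) (A : set R) : Prop :=
  forall k, K k -> ~ has_clique S k A.

(** The edges contributed before stage [n]. They have to be known first, as they decide whether
    stage [n] is skipped. *)
Fixpoint stage n : set (R * R) :=
  if n is k.+1 then
    stage k `|` [set p | clique_free (stage k) (target k) /\ D k p]
  else set0.

Definition staged_graph : set (R * R) :=
  [set p | exists2 n, clique_free (stage n) (target n) & D n p].

Local Notation E := staged_graph.

Hypothesis D_closed : forall n, closed (D n).
Hypothesis D_sym : forall n x y, D n (x, y) -> D n (y, x).
Hypothesis D_window : forall n x y, D n (x, y) -> window n `|x - y|.

Lemma stageP n p : stage n p <->
  exists2 k, (k < n)%N & clique_free (stage k) (target k) /\ D k p.
Proof.
elim: n => [|n IHn] /=; first by split=> // -[].
split=> [[/IHn[k kn kp]|np]|[k]].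
- by exists k => //; exact: leqW.
- by exists n.
- rewrite ltnS leq_eqVlt => /orP[/eqP -> np|kn kp]; first by right.
  by left; apply/IHn; exists k.
Qed.

Lemma stage_closed n : closed (stage n).
Proof.
elim: n => [|n IHn] /=; first exact: closed0.
apply: closedU => //.
have [ok|nok] := pselect (clique_free (stage n) (target n)).
- rewrite (_ : [set p | _] = D n)//.
  by apply/seteqP; split=> p //= [].
- rewrite (_ : [set p | _] = set0); first exact: closed0.
  by apply/seteqP; split=> p //= [].
Qed.

(** Edges of stage [n] are longer than [n], so near a given point only finitely many stages occur,
    and each of them is closed. *)
Lemma staged_graph_closed : closed E.
Proof.
move=> p clEp.
pose T := Num.Def.archi_bound `|p.1 - p.2|.
suff : stage T p by move=> /stageP[n _ [ok Dp]]; exists n.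
apply: stage_closed => B pB.
have pV : nbhs p [set q : R * R | `|q.1 - q.2| < T%:R].
  have : (fun q : R * R => `|q.1 - q.2|) @ p --> `|p.1 - p.2|.
    by apply: cvg_norm; apply: cvgB; [exact: cvg_fst|exact: cvg_snd].
  by move/cvgr_lt; apply; exact: archi_boundP.
have [q [[n ok Dq] [Bq qT]]] := clEp _ (filterI pB pV).
exists q; split => //; apply/stageP; exists n => //.
have := D_window (n := n) (x := q.1) (y := q.2); rewrite -surjective_pairing.
move=> /(_ Dq)/window_reach; have := reach_ge0 R n => M0 nq.
rewrite -(ltr_nat R); apply: le_lt_trans qT; apply: le_trans nq.
by rewrite -natr1; lra.
Qed.

Lemma staged_graph_sym x y : E (x, y) -> E (y, x).
Proof. by move=> [n ok /D_sym]; exists n. Qed.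

Lemma staged_graph_gt0 x y : E (x, y) -> 1 <= `|x - y|.
Proof.
move=> [n _ /D_window/window_reach]; apply: le_trans.
have := reach_ge0 R n; have : 0 <= n%:R :> R by rewrite ler0n.
by rewrite -natr1; lra.
Qed.

Lemma staged_graph_irr x : ~ E (x, x).
Proof. by move=> /staged_graph_gt0; rewrite subrr normr0 ler10. Qed.

(* Later stages only add edges longer than the diameter of the target. *)
Lemma stage_target n x y :
  target n x -> target n y -> E (x, y) -> stage n (x, y).
Proof.
move=> [/= xn _] [/= yn _] [k ok Dxy]; apply/stageP; exists k => //.
rewrite ltnNge; apply/negP => nk.
have := window_reach_le nk (D_window Dxy).
have := ler_normB x y; lra.
Qed.

Lemma clique_free_stage n :
  clique_free (stage n) (target n) <-> clique_free E (target n).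
Proof.
split=> ok k /ok; apply: contra_not => -[f [finj ft Ef]]; exists f; split => //.
- by move=> i j ij; apply: stage_target => //; exact: Ef.
- by move=> i j /Ef/stageP[m _ [okm Dm]]; exists m.
Qed.

(** The length of the edge lies in the window of stage [n], and windows of different stages are
    disjoint. *)
Lemma staged_graph_piece n x z : `|z - center R n| < radius R n / 2 ->
  `|x| <= (reach n)%:R -> E (x, z) -> D n (x, z).
Proof.
move=> zn xn [k ok Dxz].
have r1 := radius_le1 R n; have M0 := reach_ge0 R n.
have wn : window n `|x - z|.
  have c0 : (reach n)%:R + 1 <= center R n.
    have : window n (center R n) by rewrite /window /=; lra.
    move/window_reach.
    have : 1 <= n.+1%:R :> R by rewrite ler1n.
    lra.
  move: zn xn; rewrite /window /= ltr_norml ler_norml => /andP[? ?] /andP[? ?].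
  rewrite distrC ger0_norm; lra.
have wk := D_window Dxz.
have n0 : 0 <= `|x - z| by [].
have [kn|nk|<- //] := ltngtP k n.
- by have := window_lt kn wk wn; lra.
- by have := window_lt nk wn wk; lra.
Qed.

(** The slack between half the radius here and twice the radius in [D_far] absorbs the displacement
    of [z] from the centre, which may displace the target by the same amount. *)
Hypothesis D_near : forall n x z q,
  `|z - center R n| < radius R n / 2 -> `|x| + 1 <= (reach n)%:R ->
  points n q -> `|x - q| <= radius R n / 2 -> D n (x, z).

Hypothesis D_far : forall n x z, `|z - center R n| < radius R n / 2 ->
  `|x| <= (reach n)%:R -> D n (x, z) ->
  exists2 q, points n q & `|x - q| <= 2 * radius R n.

(** Letting [x] vary around [a] yields open boxes of edges, hence also the interior of the edge
    set. *)
Lemma staged_graph_extension (A B : set R) :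
  finite_set A -> finite_set B -> A `&` B = set0 -> clique_free E A ->
  exists z0, exists2 e, 0 < e & forall z, `|z - z0| < e ->
    (forall a x, A a -> `|x - a| < e -> E (x, z)) /\
    (forall b, B b -> ~ E (b, z)).
Proof.
move=> finA finB AB0 okA.
have [r rE rad_lt] : exists2 r : nat -> R, forall m, r m = m.+1%:R^-1 &
    forall e, 0 < e -> \forall m \near \oo, r m < e.
  exists (fun m => m.+1%:R^-1) => // e e0.
  exact: (near_infty_natSinv_lt (PosNum e0)).
(* A precision at which points near [A] span no new edges: non-edges are stable because the edge set
   is closed. *)
have : \forall m \near \oo, forall p, (A `*` A) p -> forall x y,
    `|x - p.1| < 2 * r m -> `|y - p.2| < 2 * r m ->
    E (x, y) -> E p.
  apply: finite_near; first exact: finite_setX.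
  move=> p _; have [Ep|/closed_nonedge[|e e0 pe]] := pselect (E p).
  - by apply: nearW.
  - exact: staged_graph_closed.
  have e2 : 0 < e / 2 by lra.
  apply: filterS (rad_lt _ e2) => m /= me x y xp yp.
  by move=> Exy; exfalso; apply: pe Exy; lra.
have : \forall m \near \oo, forall p, (A `*` B) p ->
    3 * r m < `|p.1 - p.2| :> R.
  apply: finite_near; first exact: finite_setX.
  move=> [a b] [/= Aa Bb].
  have ab : 0 < `|a - b| / 3.
    rewrite divr_gt0// normr_gt0 subr_eq0; apply/eqP => ab.
    have : (A `&` B) a by split => //; rewrite ab.
    by rewrite AB0.
  by apply: filterS (rad_lt _ ab) => m; lra.
have : \forall M \near \oo, forall x, (A `|` B) x -> `|x| <= M%:R.
  by apply: finite_bounded; rewrite finite_setU.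
move=> [M _ /(_ M (leqnn M)) AM] [m1 _ sepAB] [m2 _ edgeA].
have {}sepAB := sepAB (maxn m1 m2) (leq_maxl _ _).
have {}edgeA := edgeA (maxn m1 m2) (leq_maxr _ _).
(* With error [r / 4], points of the target are within [r + r / 4 < 2 r] of [A], points within
   [r / 4] of [A] are within [r / 2] of a centre, and [2 r + r / 4 < 3 r] keeps [B] away. The reach
   [M + 2] allows for [|x| + 1] with [|x| <= M + 1]. *)
have r0 : 0 < (maxn m1 m2).+1%:R^-1 / 4 :> R by rewrite divr_gt0// invr_gt0.
have [n [rn Mn Aq qA]] := code_exists (maxn m1 m2) M.+2 finA r0.
rewrite rE -rn in sepAB; rewrite rE -rn in edgeA; rewrite -rn in r0 Aq qA.
have r1 := radius_le1 R n.
(* A forbidden clique in the target moves to nearby points of [A], which stay distinct because no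
   point is adjacent to itself. *)
have okn : clique_free (stage n) (target n).
  apply/clique_free_stage => k Kk [g [ginj gt Eg]]; apply: (okA k Kk).
  have [h hP] : {h : 'I_k -> R &
      forall i, A (h i) /\ `|g i - h i| < 2 * radius R n}.
    apply: (@choice _ _ (fun i a => A a /\ `|g i - a| < 2 * radius R n)) => i.
    have [_ [q nq /= gq]] := gt i; have [a Aa qa] := qA q nq.
    by exists a; split => //; have := ler_distD q (g i) a; lra.
  have Eh i j : i != j -> E (h i, h j).
    move=> /Eg; have [[Ai gi] [Aj gj]] := (hP i, hP j).
    by apply: (edgeA (h i, h j)).
  exists h; split => //; first exact: edges_injective staged_graph_irr Eh.
  by move=> i; have [] := hP i.
exists (center R n), (radius R n / 4); first lra.
move=> z zn; have zn2 : `|z - center R n| < radius R n / 2 by lra.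
split=> [a x Aa xa|b Bb].
- exists n => //; have [q nq qa] := Aq a Aa; apply: D_near zn2 _ nq _.
  + have := AM a (or_introl Aa); rewrite Mn -!natr1.
    have := ler_distD 0 x a; have := lerB_dist x a; lra.
  + have := ler_distD a x q; rewrite (distrC a); lra.
- have bM : `|b| <= (reach n)%:R.
    by rewrite Mn -!natr1; have := AM b (or_intror Bb); lra.
  move=> /(staged_graph_piece zn2 bM)/(D_far zn2 bM)[q nq bq].
  have [a Aa qa] := qA q nq.
  have := sepAB (a, b) (conj Aa Bb); rewrite /= distrC.
  by have := ler_distD q b a; lra.
Qed.

Lemma staged_graph_interior (A B : set R) :
  finite_set A -> finite_set B -> A `&` B = set0 -> clique_free E A ->
  interior (pattern E A B) !=set0.
Proof.
move=> finA finB AB0 okA.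
have [z0 [e e0 ze]] := staged_graph_extension finA finB AB0 okA.
exists z0; apply/nbhs_ballP; exists e => //= z z0z [a b] [/= Aa Bb].
have [|zA zB] := ze z; first by rewrite distrC.
by split; [apply: zA Aa _; rewrite subrr normr0|exact: zB].
Qed.

Lemma staged_graph_topological :
  (forall k, K k -> (2 <= k)%N) -> topological_graph R E.
Proof.
move=> K2; split.
- exact: polish_real.
- exact: staged_graph_closed.
- exact: staged_graph_sym.
(* A single point contains no forbidden clique, all forbidden sizes being at least 2. *)
- have [||||z0 [e e0 ze]] := @staged_graph_extension [set 0] set0.
  + exact: finite_set1.
  + exact: finite_set0.
  + by rewrite setI0.
  + move=> k /K2; case: k => [|[|k]]// _ [f [finj f0 _]].
    have := finj ord0 ord_max; rewrite (f0 ord0) (f0 ord_max) => /(_ erefl).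
    by [].
  exists (0, z0); apply/nbhs_ballP; exists e => //= -[x z] [/= x0 zz0].
  have [|zA _] := ze z; first by rewrite distrC.
  by apply: zA erefl _; rewrite distrC.
- exact: staged_graph_irr.
Qed.

End staged_graph.

Lemma clique_free1 (R : realType) k (S : set (R * R)) A :
  clique_free [set k] S A <-> ~ has_clique S k A.
Proof. by split=> [/(_ k erefl)|nk _ ->]. Qed.

(** * Shift-invariant graphs: universal and triangle-free *)

Section shift_piece.
Variable R : realType.

(** For [z] at the centre and [x] in [[-reach n, reach n]], the number [center R n - |x - z|] is [x]
    itself, so this encodes the target as a set of lengths. *)
Definition shift_piece n : set (R * R) :=
  [set p | target n (center R n - `|p.1 - p.2|)].

Lemma shift_piece_closed n : closed (shift_piece n).
Proof.
apply: (@preimage_closed _ _ _ (@target R n)); last exact: target_closed.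
apply: in1W => p; apply: cvgB; first exact: cvg_cst.
by apply: cvg_norm; apply: cvgB; [exact: cvg_fst|exact: cvg_snd].
Qed.

Lemma shift_piece_sym n x y : shift_piece n (x, y) -> shift_piece n (y, x).
Proof. by rewrite /shift_piece /= distrC. Qed.

Lemma shift_piece_window n x y : shift_piece n (x, y) -> window n `|x - y|.
Proof. by move=> [/= + _]; rewrite ler_norml /window /=; lra. Qed.

Lemma center_ge n : 2 * (reach n)%:R + 1 <= center R n - (reach n)%:R - 1.
Proof.
have := @window_reach R n (center R n - (reach n)%:R - 1).
have := reach_ge0 R n; rewrite /window /= => M0.
have : 1 <= n.+1%:R :> R by rewrite ler1n.
by move=> n1 h; apply: le_trans (h _); lra.
Qed.

Lemma shift_pieceE n x z :
  `|z - center R n| < radius R n / 2 -> `|x| <= (reach n)%:R ->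
  center R n - `|x - z| = x - (z - center R n).
Proof.
move=> zn xn; rewrite distrC ger0_norm; first lra.
have := center_ge n; have := radius_le1 R n; have := reach_ge0 R n.
by move: zn xn; rewrite ltr_norml ler_norml; lra.
Qed.

Lemma shift_piece_near n x z q :
  `|z - center R n| < radius R n / 2 -> `|x| + 1 <= (reach n)%:R ->
  points n q -> `|x - q| <= radius R n / 2 -> shift_piece n (x, z).
Proof.
move=> zn xn nq xq; have r1 := radius_le1 R n.
rewrite /shift_piece /= shift_pieceE//; last by lra.
split=> /=; first by have := ler_normB x (z - center R n); lra.
exists q => //=; rewrite (_ : _ - q = (x - q) - (z - center R n)); last by lra.
by have := ler_normB (x - q) (z - center R n); lra.
Qed.

Lemma shift_piece_far n x z : `|z - center R n| < radius R n / 2 ->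
  `|x| <= (reach n)%:R -> shift_piece n (x, z) ->
  exists2 q, points n q & `|x - q| <= 2 * radius R n.
Proof.
move=> zn xn; have r0 := radius_gt0 R n.
rewrite /shift_piece /= shift_pieceE// => -[_ [q nq /= xq]]; exists q => //.
rewrite (_ : x - q = (x - (z - center R n) - q) + (z - center R n)); last lra.
have := ler_normD (x - (z - center R n) - q) (z - center R n); lra.
Qed.

Definition shift_graph K := staged_graph K shift_piece.

Lemma shift_graph_invariant K : shift_invariant (shift_graph K).
Proof.
exists [set d | exists2 n, clique_free K (stage K shift_piece n) (target n)
                         & target n (center R n - d)] => // d [n _ [/= + _]].
by have := center_ge n; have := reach_ge0 R n; rewrite ler_norml; lra.
Qed.

Lemma shift_graph_topological K : (forall k, K k -> (2 <= k)%N) ->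
  topological_graph R (shift_graph K).
Proof.
apply: staged_graph_topological.
- exact: shift_piece_closed.
- exact: shift_piece_sym.
- exact: shift_piece_window.
- exact: shift_piece_near.
- exact: shift_piece_far.
Qed.

Lemma shift_graph_interior K (A B : set R) :
  finite_set A -> finite_set B -> A `&` B = set0 ->
  clique_free K (shift_graph K) A ->
  interior (pattern (shift_graph K) A B) !=set0.
Proof.
apply: staged_graph_interior.
- exact: shift_piece_closed.
- exact: shift_piece_window.
- exact: shift_piece_near.
- exact: shift_piece_far.
Qed.

(* If [w - x] is in the window of stage [n], so is the longer of [y - x] and
   [w - y]. The two lengths then give points of the target of stage [n] whose
   difference is the third length, which contradicts that the target is
   edgeless. *)
Lemma shift_graph_triangle (x y w : R) : x < y -> y < w ->
  shift_graph [set 2%N] (x, y) -> shift_graph [set 2%N] (y, w) ->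
  ~ shift_graph [set 2%N] (x, w).
Proof.
set E := shift_graph _ => xy yw Exy Eyw [n okn Dxw].
have irrE := staged_graph_irr shift_piece_window (K := [set 2%N]).
have symE := staged_graph_sym shift_piece_sym (K := [set 2%N]).
have /clique_free_stage := okn => /(_ shift_piece_window)/clique_free1 noedge.
have wxw := shift_piece_window Dxw.
(* Lengths in different windows differ by a factor of more than 2, so an edge shorter than that from
   [x] to [w], but at least half as long, comes from the same stage. *)
have same k x' y' : `|x' - y'| < `|x - w| -> `|x - w| <= 2 * `|x' - y'| ->
    shift_piece k (x', y') -> k = n.
  move=> lt1 lt2 /shift_piece_window wk.
  have [kn|nk|//] := ltngtP k n.
  - by exfalso; have := window_lt kn wk wxw; lra.
  - by exfalso; have := window_lt nk wxw wk; have := normr_ge0 (x - w); lra.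
have nxy : `|x - y| = y - x by rewrite distrC gtr0_norm// subr_gt0.
have nyw : `|y - w| = w - y by rewrite distrC gtr0_norm// subr_gt0.
have nxw : `|x - w| = w - x.
  by rewrite distrC gtr0_norm// subr_gt0 (lt_trans xy).
have shE := @shift_invariantE R E _ _ _ _ (shift_graph_invariant _).
apply: noedge.
have [le|lt] := leP (y - x) (w - y).
- have [k _ Dyw] := Eyw.
  have kn : k = n by apply: same Dyw; lra.
  rewrite kn in Dyw; apply: has_clique2 irrE symE Dxw Dyw _ => /=.
  by apply: shE Exy _; left; rewrite nxw nyw; lra.
- have [k _ Dxy] := Exy.
  have kn : k = n by apply: same Dxy; lra.
  rewrite kn in Dxy; apply: has_clique2 irrE symE Dxw Dxy _ => /=.
  by apply: shE Eyw _; left; rewrite nxw nxy; lra.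
Qed.

Lemma shift_graph_no_triangle A : ~ has_clique (shift_graph [set 2%N]) 3 A.
Proof.
move=> [f [finj _ Ef]].
have ordered i j k : f i < f j -> f j < f k -> False.
  move=> ij jk; apply: (shift_graph_triangle ij jk); apply: Ef.
  - by apply: contraTneq ij => ->; rewrite ltxx.
  - by apply: contraTneq jk => ->; rewrite ltxx.
  - by apply: contraTneq (lt_trans ij jk) => ->; rewrite ltxx.
pose a : 'I_3 := inord 0; pose b : 'I_3 := inord 1; pose c : 'I_3 := inord 2.
have neq (i j : 'I_3) : (i : nat) != j -> f i != f j.
  by rewrite (inj_eq finj) -val_eqE.
have ab : f a != f b by apply: neq; rewrite /a /b !inordK.
have ac : f a != f c by apply: neq; rewrite /a /c !inordK.
have bc : f b != f c by apply: neq; rewrite /b /c !inordK.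
case: (ltgtP (f a) (f b)) ab => // ab _;
  case: (ltgtP (f b) (f c)) bc => // bc _.
- exact: ordered ab bc.
- case: (ltgtP (f a) (f c)) ac => // ac _; first exact: ordered ac bc.
  exact: ordered ac ab.
- case: (ltgtP (f a) (f c)) ac => // ac _; first exact: ordered ab ac.
  exact: ordered bc ac.
- exact: ordered bc ab.
Qed.

End shift_piece.

(** * [K_s]-free universal graphs for every [s > 2] *)

Section step_piece.
Variable R : realType.

(** The position of the larger endpoint is prescribed, not just the length. Writing this with [max]
    and [min] makes the piece symmetric and closed. *)
Definition step_piece n : set (R * R) :=
  [set p | `|Num.max p.1 p.2 - center R n| <= 1 /\ target n (Num.min p.1 p.2)].

Lemma step_piece_closed n : closed (step_piece n).
Proof.
apply: closedI.
  apply: closed_norm_le => p; apply: cvgB; last exact: cvg_cst.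
  exact: max_continuous.
apply: (@preimage_closed _ _ _ (@target R n)); last exact: target_closed.
by apply: in1W => p; exact: min_continuous.
Qed.

Lemma step_piece_sym n x y : step_piece n (x, y) -> step_piece n (y, x).
Proof. by rewrite /step_piece /= maxC minC. Qed.

Lemma step_piece_window n x y : step_piece n (x, y) -> window n `|x - y|.
Proof.
move=> [/= + [/= + _]]; have := center_ge R n; have := reach_ge0 R n.
have -> : `|x - y| = Num.max x y - Num.min x y.
  by case: (leP x y) => xy; [rewrite distrC ger0_norm|rewrite gtr0_norm]; lra.
by rewrite !ler_norml /window /=; lra.
Qed.

Lemma step_pieceE n x z :
  `|z - center R n| < radius R n / 2 -> `|x| <= (reach n)%:R ->
  Num.max x z = z /\ Num.min x z = x.
Proof.
move=> zn xn; suff xz : x < z by rewrite max_r ?min_l// ltW.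
have := center_ge R n; have := radius_le1 R n; have := reach_ge0 R n.
by move: zn xn; rewrite ltr_norml ler_norml; lra.
Qed.

Lemma step_piece_near n x z q :
  `|z - center R n| < radius R n / 2 -> `|x| + 1 <= (reach n)%:R ->
  points n q -> `|x - q| <= radius R n / 2 -> step_piece n (x, z).
Proof.
move=> zn xn nq xq; have r1 := radius_le1 R n; have r0 := radius_gt0 R n.
have xn' : `|x| <= (reach n)%:R by lra.
rewrite /step_piece /=; have [-> ->] := step_pieceE zn xn'.
split; first lra.
by split=> //; exists q => //=; lra.
Qed.

Lemma step_piece_far n x z : `|z - center R n| < radius R n / 2 ->
  `|x| <= (reach n)%:R -> step_piece n (x, z) ->
  exists2 q, points n q & `|x - q| <= 2 * radius R n.
Proof.
move=> zn xn; have r0 := radius_gt0 R n.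
rewrite /step_piece /=; have [-> ->] := step_pieceE zn xn.
by move=> [_ [_ [q nq /= xq]]]; exists q => //; lra.
Qed.

(** Different centres are more than 2 apart, so the larger endpoint is within 1 of only one of
    them. *)
Lemma step_piece_inj k n x y z :
  step_piece k (x, z) -> step_piece n (y, z) -> x <= z -> y <= z -> k = n.
Proof.
have far i j : (i < j)%N -> center R i + 2 < center R j.
  move=> ij; have [Mi Mj] := (reach_ge0 R i, reach_ge0 R j).
  have := @window_lt R i j (center R i + (reach i)%:R + 1)
    (center R j - (reach j)%:R - 1) ij.
  have := center_ge R i; rewrite /window /= => ? h.
  have {}h := h ltac:(lra) ltac:(lra); lra.
move=> [/= + _] [/= + _] xz yz; rewrite !max_r// !ler_norml.
by have [/far|/far|//] := ltngtP k n => ? ? ?; exfalso; lra.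
Qed.

Definition step_graph K := staged_graph K step_piece.

(* The largest vertex determines the stage of all its edges, so all other
   vertices lie in the target of that stage. *)
Lemma step_graph_no_clique s A : ~ has_clique (step_graph [set s.+1]) s.+2 A.
Proof.
set E := step_graph _ => -[f [finj _ Ef]].
pose i0 := [arg max_(i > ord0) f i]%O.
have fi0 i : f i <= f i0 by rewrite /i0; case: arg_maxP => // m _; apply.
have [n okn Dn] : E (f (lift i0 ord0), f i0).
  by apply: Ef; rewrite eq_sym neq_lift.
have /clique_free_stage := okn => /(_ step_piece_window)/clique_free1; apply.
exists (f \o lift i0); split.
- by move=> i j /finj/lift_inj.
- move=> i /=; have [k _ Dk] : E (f (lift i0 i), f i0).
    by apply: Ef; rewrite eq_sym neq_lift.
  have kn := step_piece_inj Dk Dn (fi0 _) (fi0 _); rewrite kn in Dk.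
  by have [_ /=] := Dk; rewrite min_l.
- by move=> i j ij; apply: Ef; rewrite (inj_eq lift_inj).
Qed.

Lemma step_graph_universal s :
  topologically_Ks_free_universal R s.+3 (step_graph [set s.+2]).
Proof.
split; last move=> A B finA finB _ _ AB0 /clique_free1 okA.
- apply: staged_graph_topological; last by move=> k ->.
  + exact: step_piece_closed.
  + exact: step_piece_sym.
  + exact: step_piece_window.
  + exact: step_piece_near.
  + exact: step_piece_far.
- exact: step_graph_no_clique.
- apply: (@staged_graph_interior _ [set s.+2]) => //.
  + exact: step_piece_closed.
  + exact: step_piece_window.
  + exact: step_piece_near.
  + exact: step_piece_far.
Qed.

End step_piece.

(** * Purity and conclusion *)

(** If [x] and [y] had the same neighbours, the pattern of [{x}] against [{y}] would be empty. *)
Lemma interior_pattern_pure (X : topologicalType) (E : set (X * X)) :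
  (forall A B, finite_set A -> finite_set B -> A `&` B = set0 ->
    interior (pattern E A B) !=set0) -> pure_graph E.
Proof.
move=> univE x y xy Exy.
have [|||z /interior_subset/(_ (x, y))] := univE [set x] [set y].
- exact: finite_set1.
- exact: finite_set1.
- by apply/seteqP; split=> // z [-> /= /xy].
- by rewrite /= Exy => -[].
Qed.

Theorem theorem5 (R : realType) :
  ((exists E : set (R * R),
      topologically_universal R E /\ shift_invariant E) /\
   (exists E : set (R * R),
      topologically_Ks_free_universal R 3 E /\ shift_invariant E)) /\
  ((forall s : nat, (3 < s)%N ->
      exists E : set (R * R), topologically_Ks_free_universal R s E) /\
   (forall s : nat, (3 < s)%N ->
      ~ exists E : set (R * R),
          topologically_Ks_free_universal R s E /\ shift_invariant E)).
Proof.
split; split.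
- exists (@shift_graph R set0); split; last exact: shift_graph_invariant.
  have univE A B : finite_set A -> finite_set B -> A `&` B = set0 ->
      interior (pattern (@shift_graph R set0) A B) !=set0.
    by move=> finA finB AB0; apply: shift_graph_interior.
  split => //; first exact: shift_graph_topological.
  exact: interior_pattern_pure.
- exists (@shift_graph R [set 2%N]); split; last exact: shift_graph_invariant.
  split; first by apply: shift_graph_topological => k ->.
  + exact: shift_graph_no_triangle.
  + move=> A B finA finB _ _ AB0 /clique_free1.
    exact: shift_graph_interior.
- case=> [|[|[|s]]]// _; exists (@step_graph R [set s.+2]).
  exact: step_graph_universal.
- by move=> s s3 [E [univE /(shift_invariant_not_universal s3)]].
Qed.
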